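(* Let $\mathcal{X}\subseteq[0,1]^d$ be an infinite compact set, let $m\ge2$, and let $\psi_1,\dots,\psi_K:\mathcal{X}\to\mathbb{R}$ be real-valued continuous functions. Being continuous on a compact set, they are taken to be Lipschitz, with constants $L_1,\dots,L_K$, and without loss of generality (by scaling the moment functions) $\max_{k}L_k=1$. Let $\hat Q_1,\dots,\hat Q_m$ be empirical distributions of training sequences in $\mathcal{X}$. Let $0<\Delta<\eta_0<\eta_{\max}$, $\eta\in[\Delta,\eta_0]$, and $\epsilon>0$ with $\eta+\epsilon\le\eta_0$. Let $\mathcal{S}_N=\{z_1,\dots,z_N\}$ be the discretization of $\mathcal{X}$ given by a grid of $N=\lceil \epsilon^{-d}\rceil$ equally spaced points such that $\min_{j\in[N]}\|z_j-x\|\le\epsilon$ for every $x\in\mathcal{X}$. Let $$\gamma=\inf_\phi\ \sup_{P_i\in\mathcal{P}_i^\eta,\ i\in[m]}P_E(\phi;P_1,\dots,P_m)$$ be the optimal value of the minmax Bayes formulation. Let $\phi_N^*$ be an optimal decision rule of the approximate problem $$\inf_{\phi_N}\ \sup_{P_{i,N}\in\mathcal{P}_{i,N}^{\eta+\epsilon},\ i\in[m]}\ 1-\frac1m\sum_{i=1}^m\sum_{j=1}^N\phi_{i,N}(z_j)\,p_{i,N}(z_j),$$ and let the robust test $\phi^*$ with 1-NN kernel smoothing be defined by $$\phi^*(x)=\phi_N^*(z_x),\qquad z_x\in\mathop{\arg\min}_{z_j\in\mathcal{S}_N}\|x-z_j\|,\qquad x\in\mathcal{X}.$$ Then $$\sup_{P_i\in\mathcal{P}_i^\eta,\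 i\in[m]}P_E(\phi^*;P_1,\dots,P_m)-\gamma\le L_0\,\epsilon,$$ where $L_0$ is the Lipschitz constant on $[\Delta,\eta_0]$ of the function $g$ mapping a radius $r$ to the optimal value $g(r)=\inf_\phi\sup_{P_i\in\mathcal{P}_i^{r},\,i\in[m]}P_E(\phi;P_1,\dots,P_m)$.
   Context: $[n]=\{1,\dots,n\}$. $\mathcal{P}$ is the set of all Borel probability measures on $\mathcal{X}$. For each $i\in[m]$, $\hat Q_i=\frac1{n_i}\sum_{j=1}^{n_i}\delta(\hat x_{i,j})$ is the empirical distribution of the training observations $\hat x_{i,1},\dots,\hat x_{i,n_i}$ under hypothesis $i$, where $\delta(x)$ is the Dirac measure at $x$; $E_P[\psi]$ is the expectation of $\psi(X)$ under $X\sim P$. For a radius $r>0$, $\mathcal{P}_i^{r}=\{P\in\mathcal{P}:|E_P[\psi_k]-E_{\hat Q_i}[\psi_k]|\le r,\ k\in[K]\}$ is the uncertainty set under hypothesis $i$, and $\mathcal{P}_{i,N}^{r}$ is the set of distributions $P$ supported on $\mathcal{S}_N$ with $|E_P[\psi_k]-E_{\hat Q_i}[\psi_k]|\le r$ for all $k\in[K]$; an element $P_{i,N}$ has probability mass function $p_{i,N}$ on $\mathcal{S}_N$. $\eta_{\max}$ is the maximum radius such that the uncertainty sets do not overlap. A decision rule on $\mathcal{X}$ is a measurable $\phi=(\phi_1,\dots,\phi_m):\mathcal{X}\to\Delta_m$, where $\Delta_m=\{v\in[0,1]^m:\sum_iv_i=1\}$ is the probability simplex; hypothesis $i$ is accepted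 at $x$ with probability $\phi_i(x)$. A decision rule on $\mathcal{S}_N$ is $\phi_N=(\phi_{1,N},\dots,\phi_{m,N})$ with $\phi_{i,N}(z_j)\in[0,1]$ and $\sum_{i=1}^m\phi_{i,N}(z_j)=1$ for every $j\in[N]$. The nearest-point assignment $x\mapsto z_x$ corresponds to a partition $\{\mathcal{A}_1,\dots,\mathcal{A}_N\}$ of $\mathcal{X}$ with $z_x=z_j$ and $\|x-z_j\|\le\epsilon$ for $x\in\mathcal{A}_j$. The Bayes error probability with equal priors is $P_E(\phi;P_1,\dots,P_m)=1-\frac1m\sum_{i=1}^m\int_{\mathcal{X}}\phi_i(x)\,dP_i(x)$. $\|\cdot\|$ is the norm on $\mathbb{R}^d$. *)

(* Defs.v *)
From HB Require Import structures.
From mathcomp Require Export all_boot all_order all_algebra.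
From mathcomp Require Export all_classical all_reals all_analysis.

Set Implicit Arguments.
Unset Strict Implicit.
Unset Printing Implicit Defensive.

Export Order.TTheory GRing.Theory Num.Theory.
Export numFieldNormedType.Exports.

Local Open Scope classical_set_scope.
Local Open Scope ring_scope.

(* R^d with its Borel sigma-algebra. A Borel probability measure on a compact
   set X is represented by a probability P on R^d with P X = 1; functions on X
   are total functions whose values outside X are irrelevant. *)
Definition borelRV (R : realType) (d : nat) :=
  g_sigma_algebraType (@open 'rV[R]_d).

Definition is_norm (R : realType) (d : nat) (nrm : 'rV[R]_d -> R) : Prop :=
  [/\ forall x y, nrm (x + y) <= nrm x + nrm y,
      forall a x, nrm (a *: x) = `|a| * nrm x &
      forall x, nrm x = 0 -> x = 0].

Definition lipschitz_wrt (R : realType) (d : nat) (nrm : 'rV[R]_d -> R)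
    (X : set 'rV[R]_d) (f : 'rV[R]_d -> R) (L : R) : Prop :=
  forall x y, X x -> X y -> `|f x - f y| <= L * nrm (x - y).

Definition is_lipschitz_constant (R : realType) (D : set R) (g : R -> R)
    (L : R) : Prop :=
  L.-lipschitz_D g /\ forall L', L'.-lipschitz_D g -> L <= L'.

(* The points z_j form a grid if they are pairwise distinct and lie on an
   axis-parallel lattice, equally spaced with step h_l along the axis l. *)
Definition is_grid (R : realType) (d N : nat) (z : 'I_N -> 'rV[R]_d) : Prop :=
  injective z /\
  exists a h : 'rV[R]_d, (forall l, 0 < h 0 l) /\
    forall j l, exists k : int, z j 0 l = a 0 l + k%:~R * h 0 l.

Section robust_testing.
Context {R : realType} {d : nat}.
Local Notation E := 'rV[R]_d.
Local Notation T := (borelRV R d).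
Variables (X : set E) (m K : nat) (psi : 'I_K -> E -> R).

Definition empirical (n : nat) (xhat : nat -> E) : {measure set T -> \bar R} :=
  mscale (n%:R^-1)%:nng (msum (fun j => \d_(xhat j : T)) n).

Definition expect (P : {measure set T -> \bar R}) (f : E -> R) : R :=
  (\int[P]_(x in (X : set T)) f x)%R.

(* The distributions supported on S with moments r-close to those of Q. *)
Definition moment_ball (S : set E) (Q : {measure set T -> \bar R}) (r : R) :
    set (probability T R) :=
  [set P : probability T R | P (S : set T) = 1%E /\
           forall k, `|expect P (psi k) - expect Q (psi k)| <= r].

Variable Q : 'I_m -> {measure set T -> \bar R}.

Definition uncertainty_set (r : R) (i : 'I_m) : set (probability T R) :=
  moment_ball X (Q i) r.

(* The maximal radius is a supremum: at the critical radius itself the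
   (closed) uncertainty sets may touch. *)
Definition eta_max : \bar R :=
  ereal_sup [set r%:E | r in [set r : R |
    0 < r /\ trivIset setT (uncertainty_set r)]].

Definition decision_rule (phi : 'I_m -> E -> R) : Prop :=
  [/\ forall i, measurable_fun (X : set T) (phi i : T -> R),
      forall i x, X x -> 0 <= phi i x <= 1 &
      forall x, X x -> \sum_(i < m) phi i x = 1].

Definition error_prob (phi : 'I_m -> E -> R) (P : 'I_m -> probability T R) : R :=
  1 - m%:R^-1 * \sum_(i < m) expect (P i) (phi i).

(* [sup] and [inf] below are only meaningful for r >= 0, when the sets of
   values are nonempty (Q i has the right moments) and contained in [0, 1]. *)
Definition worst_error (r : R) (phi : 'I_m -> E -> R) : R :=
  sup [set error_prob phi P | P in [set P : 'I_m -> probability T R | forall i, uncertainty_set r i (P i)]].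

Definition minmax_error (r : R) : R :=
  inf [set worst_error r phi | phi in decision_rule].

Variables (N : nat) (z : 'I_N -> E).

Definition grid_rule (phi : 'I_m -> 'I_N -> R) : Prop :=
  (forall i j, 0 <= phi i j <= 1) /\ forall j, \sum_(i < m) phi i j = 1.

Definition grid_uncertainty_set (r : R) (i : 'I_m) : set (probability T R) :=
  moment_ball (range z) (Q i) r.

Definition grid_error (phi : 'I_m -> 'I_N -> R) (P : 'I_m -> probability T R) : R :=
  1 - m%:R^-1 * \sum_(i < m) \sum_(j < N)
        phi i j * fine (P i ([set z j] : set T)).

Definition grid_worst_error (r : R) (phi : 'I_m -> 'I_N -> R) : R :=
  sup [set grid_error phi P |
       P in [set P : 'I_m -> probability T R | forall i, grid_uncertainty_set r i (P i)]].

Definition optimal_grid_rule (r : R) (phi : 'I_m -> 'I_N -> R) : Prop :=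
  grid_rule phi /\
  forall phi', grid_rule phi' -> grid_worst_error r phi <= grid_worst_error r phi'.

(* x |-> z_(c x) is a nearest-point assignment. The cells must be Borel for the
   smoothed rule to be measurable; ties are broken in any such way. *)
Definition nearest_assignment (nrm : E -> R) (c : E -> 'I_N) : Prop :=
  (forall x, X x -> forall j, nrm (x - z (c x)) <= nrm (x - z j)) /\
  forall j, measurable ([set x | X x /\ c x = j] : set T).

Definition smoothed_rule (c : E -> 'I_N) (phi : 'I_m -> 'I_N -> R) :
    'I_m -> E -> R :=
  fun i x => phi i (c x).

End robust_testing.

(* Main.v *)
From mathcomp Require Import ring lra measurable_realfun.
Require Import Defs.

(** Write g for the minmax value as a function of the radius.

    Moving the mass of each cell of the nearest-point partition to its grid
    point changes no error and, the moments being 1-Lipschitz, changes each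
    moment by at most eps; hence the smoothed rule has on radius eta at most the
    worst error of the grid rule on radius eta + eps.  Conversely a rule on X
    restricts to the grid, where every grid distribution is also a competitor
    on X, so the optimal grid value on radius eta + eps is at most
    g (eta + eps).

    That g is Lipschitz needs no duality: mixing a distribution of radius s with
    the empirical one in proportion r / s gives a distribution of radius r, so
    that g r >= (r / s) g s.  As 0 <= g <= 1 and g is nondecreasing, g is
    1/a-Lipschitz on [a, b] whenever a > 0. *)

Set Implicit Arguments.
Unset Strict Implicit.
Unset Printing Implicit Defensive.

Local Open Scope classical_set_scope.
Local Open Scope ring_scope.

(** * Probability measures: mixtures, and integrals over finitely many cells *)

Lemma probability_of_measure d (T : measurableType d) (R : realType)
    (mu : {measure set T -> \bar R}) : mu setT = 1%E ->
  exists P : probability T R, forall A, P A = mu A.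
Proof.
(* [mnormalize] divides by the total mass, here 1, so its Dirac default is never reached. *)
move=> mu1; exists (mnormalize mu (dirac (point : T))) => A.
by rewrite /= /mnormalize mu1 /= onee_eq0/= invr1 mule1.
Qed.

Lemma probability_pushforward d d' (T : measurableType d)
    (T' : measurableType d') (R : realType) (P : probability T R) (f : T -> T') :
  measurable_fun setT f ->
  exists P' : probability T' R, forall A, P' A = P (f @^-1` A).
Proof. by move=> mf; exists (distribution P (mfun_Sub (mem_set mf))). Qed.

Section probability_expectation.
Context d (T : measurableType d) (R : realType).
Variables (X : set T) (mX : measurable X).
Implicit Types (P Q : probability T R) (f : T -> R) (M : R).

Lemma bounded_integrable P f M : measurable_fun X f ->
  (forall x, X x -> `|f x| <= M) -> P.-integrable X (EFin \o f).
Proof.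
move=> mf fM; apply: measurable_bounded_integrable => //.
  by rewrite ltey_eq fin_num_measure.
exists M; split; first exact: num_real.
by move=> y My x /fM /le_trans; apply; exact: ltW.
Qed.

(** One mixture has to serve all moments and the decision rule at once, so [f] is quantified after
    the existential. *)
Lemma Rintegral_mixture P Q (t : R) : 0 <= t <= 1 ->
  exists P' : probability T R,
    (forall A, measurable A ->
       P' A = (t%:E * P A + (1 - t)%:E * Q A)%E) /\
    forall f M, measurable_fun X f -> (forall x, X x -> `|f x| <= M) ->
      (\int[P']_(x in X) f x = t * \int[P]_(x in X) f x
                             + (1 - t) * \int[Q]_(x in X) f x)%R.
Proof.
move=> /andP[t0 t1].
have u0 : 0 <= 1 - t by rewrite subr_ge0.
pose nu := measure_add (mscale (NngNum t0) P) (mscale (NngNum u0) Q).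
have nuE A : nu A = (t%:E * P A + (1 - t)%:E * Q A)%E.
  by rewrite /nu measure_addE.
have [P' P'E] : exists P' : probability T R, forall A, P' A = nu A.
  apply: probability_of_measure; rewrite [LHS]nuE.
  by rewrite !probability_setT !mule1 -EFinD addrC subrK.
have P'PQ A : P' A = (t%:E * P A + (1 - t)%:E * Q A)%E.
  by rewrite P'E; exact: nuE.
exists P'; split=> // f M mf fM.
have int P0 : P0.-integrable X (EFin \o f) by exact: bounded_integrable fM.
have intM P0 : P0.-integrable X (EFin \o cst M).
  by apply: (@bounded_integrable _ _ `|M|) => //; exact: measurable_cst.
(* The library integrates nonnegative functions against sums of measures, so
   [f] is shifted by its bound [M]. *)
have splitM P0 :
    \int[P0]_(x in X) f x = \int[P0]_(x in X) (f x + M) - M * fine (P0 X).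
  by rewrite (RintegralD mX (int P0) (intM P0)) (Rintegral_cst _ mX) addrK.
have fM0 x : X x -> (0 <= (f x + M)%:E)%E.
  by move=> /fM; rewrite ler_norml lee_fin -lerBlDr sub0r => /andP[].
have mfM : measurable_fun X (fun x => (f x + M)%:E).
  by apply/measurable_EFinP; apply: measurable_funD.
have fin P0 : (\int[P0]_(x in X) (f x + M)%:E)%E \is a fin_num.
  by apply: integrable_fin_num => //; exact: (integrableD mX (int P0) (intM P0)).
have P'M : \int[P']_(x in X) (f x + M) =
    t * \int[P]_(x in X) (f x + M) + (1 - t) * \int[Q]_(x in X) (f x + M).
  rewrite /Rintegral (eq_measure_integral nu); last by move=> A _ _; exact: P'E.
  rewrite ge0_integral_measure_add// !ge0_integral_mscale//.
  by rewrite fineD ?fineM ?fin_numM//; exact: fin.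
rewrite !splitM P'M P'PQ fineD ?fineM ?fin_numM ?fin_num_measure//=.
by rewrite !mulrBr !mulrDr; lra.
Qed.

(** The cells carry full mass, so [f] agrees almost everywhere with the step function of values
    [a j]. They may fail to cover [X]: this serves both the partition of [X] and the singletons of
    the grid. *)
Lemma Rintegral_cells P (N : nat) (A : 'I_N -> set T) (a : 'I_N -> R) f M :
  measurable_fun X f -> (forall x, X x -> `|f x| <= M) ->
  (forall j, measurable (A j)) -> trivIset setT A ->
  (forall j, A j `<=` X) -> P (\bigcup_j A j) = 1%E ->
  (forall j x, A j x -> f x = a j) ->
  \int[P]_(x in X) f x = \sum_(j < N) a j * fine (P (A j)).
Proof.
move=> mf fM mA tA AX PA fa.
have mU : measurable (\bigcup_j A j) by apply: fin_bigcup_measurable.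
have int j : P.-integrable X (fun x => (a j * \1_(A j) x)%:E).
  apply: (@bounded_integrable _ _ `|a j|).
    apply: measurable_funM; first exact: measurable_cst.
    exact: measurable_indic.
  move=> x _; rewrite normrM ler_piMr// indicE.
  by case: (_ \in _); rewrite ?normr1 ?normr0.
pose g x := \sum_(j < N) a j * \1_(A j) x.
have gE x : (g x)%:E = (\sum_(j < N) (a j * \1_(A j) x)%:E)%E.
  by rewrite sumEFin.
transitivity (\int[P]_(x in X) g x).
  rewrite /Rintegral; congr fine; apply: ae_eq_integral => //.
  - exact/measurable_EFinP.
  - apply: measurable_int; under eq_fun do rewrite gE.
    exact: integrable_sum.
  exists (~` \bigcup_j A j); split.
  - exact: measurableC.
  - by rewrite [LHS]probability_setC// PA subee.
  move=> x /= /not_implyP[Xx nfg] [j _ Ajx]; apply: nfg; congr EFin.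
  rewrite /g (bigD1 j)//= indicE mem_set// mulr1 big1 ?addr0 ?(fa j)// => i ij.
  rewrite indicE memNset ?mulr0// => Aix; move/eqP: ij; apply.
  by apply: tA => //; exists x.
have intE j :
    (\int[P]_(x in X) (a j * \1_(A j) x)%:E)%E = (a j * fine (P (A j)))%:E.
  rewrite -[LHS]fineK ?integrable_fin_num//; congr EFin.
  rewrite [LHS]RintegralZl//; last first.
    apply: (@bounded_integrable _ _ 1); first exact: measurable_indic.
    by move=> x _; rewrite indicE; case: (_ \in _); rewrite ?normr1 ?normr0.
  by rewrite /Rintegral integral_indic// setIidl.
rewrite /Rintegral; under eq_integral do rewrite gE.
by rewrite integral_sum//; under eq_bigr do rewrite intE; rewrite sumEFin.
Qed.
End probability_expectation.

Lemma measurable_comp_cells d d' (T : measurableType d) (T' : measurableType d')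
    (X : set T) (N : nat) (c : T -> 'I_N) (a : 'I_N -> T') :
  (forall j, measurable [set x | X x /\ c x = j]) ->
  measurable_fun X (fun x => a (c x)).
Proof.
move=> mc _ B mB.
rewrite (_ : _ `&` _ =
    \bigcup_(j in [set j | B (a j)]) [set x | X x /\ c x = j]); last first.
  apply/seteqP; split=> [x [Xx Bx]|x [j Bj [Xx cxj]]]; first by exists (c x).
  by split=> //=; rewrite cxj.
by apply: fin_bigcup_measurable => //; exact: finite_finset.
Qed.

(** * Borel sets and continuous functions on compact sets *)

Section borel.
Context {R : realType} {d : nat}.
Local Notation T := (borelRV R d).
Implicit Types X : set 'rV[R]_d.

Lemma open_borel X : open X -> measurable (X : set T).
Proof. exact: sub_sigma_algebra. Qed.

Lemma closed_borel X : closed X -> measurable (X : set T).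
Proof. by move=> /closed_openC/open_borel/measurableC; rewrite setCK. Qed.

Lemma compact_borel X : compact X -> measurable (X : set T).
Proof. by move=> cX; apply: closed_borel; exact: compact_closed. Qed.

Lemma set1_borel (x : 'rV[R]_d) : measurable ([set x] : set T).
Proof. by apply: compact_borel; exact: compact_set1. Qed.

(** Open intervals generate the Borel sets of the line, and their preimages are traces on [X] of
    open sets. *)
Lemma within_continuous_borel X (f : 'rV[R]_d -> R) : measurable (X : set T) ->
  {within X, continuous f} -> measurable_fun (X : set T) (f : T -> R).
Proof.
move=> mX /continuousP cf; apply: (measurability _ (RGenOpens.measurableE R)).
move=> _ [_ [a [b ->] <-]].
have /open_subspaceP[V oV VX] : open (f @^-1` `]a, b[ : set (subspace X)).
  exact/cf/interval_open.
by rewrite setIC -VX; apply: measurableI => //; exact: open_borel.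
Qed.

Lemma within_continuous_bounded X (f : 'rV[R]_d -> R) : compact X ->
  {within X, continuous f} -> exists M, forall x, X x -> `|f x| <= M.
Proof.
move=> cX cf; have /compact_bounded[M [_ Mf]] := continuous_compact cf cX.
(* Only numbers strictly above [M] are known to be bounds. *)
by exists (M + 1) => x Xx; apply: Mf; [rewrite ltrDl|exists x].
Qed.
End borel.

(** * The minmax error as a function of the radius *)

Section testing.
Context {R : realType} {d : nat}.
Local Notation E := 'rV[R]_d.
Local Notation T := (borelRV R d).
Variables (X : set E) (m K : nat) (psi : 'I_K -> E -> R).
Implicit Types (phi : 'I_m -> E -> R) (P : 'I_m -> probability T R) (r s : R).
(** The empirical distributions come as plain measures [Q]; [Q0] repackages them as probabilities,
    so that they can themselves be competitors. *)
Variables (Q : 'I_m -> {measure set T -> \bar R})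
  (Q0 : 'I_m -> probability T R).
Hypothesis cX : compact X.
Hypothesis m0 : (0 < m)%N.
Hypothesis cpsi : forall k, {within X, continuous (psi k)}.
Hypothesis QQ0 : forall i A, measurable A -> Q0 i A = Q i A.
Hypothesis Q0X : forall i, Q0 i (X : set T) = 1%E.

Let mX : measurable (X : set T) := compact_borel cX.

Lemma expect_model i f : expect X (Q i) f = expect X (Q0 i) f.
Proof.
by congr fine; apply: eq_measure_integral => A mA _; symmetry; exact: QQ0.
Qed.

(** Keeps the set of competitors nonempty, without which [sup] would be a default value. *)
Lemma model_uncertainty r i : 0 <= r -> uncertainty_set X psi Q r i (Q0 i).
Proof. by move=> r0; split=> // k; rewrite expect_model subrr normr0. Qed.

Lemma uncertainty_mono r s i : r <= s ->
  uncertainty_set X psi Q r i `<=` uncertainty_set X psi Q s i.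
Proof. by move=> rs P [PX Pr]; split=> // k; exact: le_trans rs. Qed.

Lemma decision_rule_normr phi i x :
  decision_rule X phi -> X x -> `|phi i x : R| <= 1.
Proof. by move=> [_ phi01 _] /(phi01 i)/andP[p0 p1]; rewrite ger0_norm. Qed.

Lemma expect_rule (phi : 'I_m -> E -> R) i (P : probability T R) :
  decision_rule X phi ->
  0 <= expect X P (phi i) <= 1.
Proof.
move=> dphi; have [mphi phi01 _] := dphi; apply/andP; split.
  by apply: Rintegral_ge0 => x Xx; have /andP[] := phi01 i x Xx.
apply: (@le_trans _ _ (\int[P]_(x in (X : set T)) 1)%R).
  apply: le_Rintegral => //.
  - by apply: bounded_integrable => // x Xx; exact: decision_rule_normr.
  - apply: (@bounded_integrable _ _ _ _ mX _ _ `|1|) => //; exact: measurable_cst.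
  - by move=> x Xx; have /andP[] := phi01 i x Xx.
rewrite Rintegral_cst// mul1r -lee_fin fineK ?fin_num_measure//.
exact: probability_le1.
Qed.

Lemma error_bounds (phi : 'I_m -> E -> R) P : decision_rule X phi ->
  0 <= error_prob X phi P <= 1.
Proof.
move=> dphi; rewrite subr_ge0 gerBl; apply/andP; split; last first.
  apply: mulr_ge0; first by rewrite invr_ge0.
  by apply: sumr_ge0 => i _; have /andP[] := expect_rule i (P i) dphi.
rewrite mulrC ler_pdivrMr ?ltr0n// mul1r.
have /le_trans : \sum_(i < m) expect X (P i) (phi i) <= \sum_(i < m) 1.
  by apply: ler_sum => i _; have /andP[] := expect_rule i (P i) dphi.
by apply; rewrite sumr_const card_ord.
Qed.

Let errors r phi := [set error_prob X phi P |
  P in [set P : 'I_m -> probability T R |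
         forall i, uncertainty_set X psi Q r i (P i)]].

Lemma worst_error_ub r phi P : decision_rule X phi ->
  (forall i, uncertainty_set X psi Q r i (P i)) ->
  error_prob X phi P <= worst_error X psi Q r phi.
Proof.
move=> dphi UP; apply: (@ub_le_sup _ (errors r phi)); last by exists P.
by exists 1 => _ [P' _ <-]; have /andP[] := error_bounds P' dphi.
Qed.

Lemma worst_error_le r phi b : 0 <= r ->
  (forall P, (forall i, uncertainty_set X psi Q r i (P i)) ->
     error_prob X phi P <= b) ->
  worst_error X psi Q r phi <= b.
Proof.
move=> r0 Pb; apply: (@ge_sup _ (errors r phi)).
  by exists (error_prob X phi Q0), Q0 => // i; exact: model_uncertainty.
by move=> _ [P UP <-]; exact: Pb.
Qed.

Lemma worst_error_ge0 r phi : 0 <= r -> decision_rule X phi ->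
  0 <= worst_error X psi Q r phi.
Proof.
move=> r0 dphi; have /andP[e0 _] := error_bounds Q0 dphi.
by apply: (le_trans e0); apply: worst_error_ub => // i; exact: model_uncertainty.
Qed.

Lemma minmax_error_le r phi : 0 <= r -> decision_rule X phi ->
  minmax_error X psi Q r <= worst_error X psi Q r phi.
Proof.
move=> r0 dphi; apply: ge_inf; last by exists phi.
by exists 0 => _ [phi' dphi' <-]; exact: worst_error_ge0.
Qed.

(** Witness that decision rules exist, so that the infimum over them is meaningful. *)
Lemma uniform_rule : decision_rule X (fun (_ : 'I_m) _ => m%:R^-1).
Proof.
split=> [i|i x _|x _]; first exact: measurable_cst.
  by rewrite invr_ge0 ler0n invf_le1 ?ltr0n// ler1n.
by rewrite sumr_const card_ord -[LHS]mulr_natr mulVf// pnatr_eq0 -lt0n.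
Qed.

Lemma minmax_error_le1 r : 0 <= r -> minmax_error X psi Q r <= 1.
Proof.
move=> r0; apply: (le_trans (minmax_error_le r0 uniform_rule)).
apply: worst_error_le => // P _.
by have /andP[] := error_bounds P uniform_rule.
Qed.

Lemma le_minmax_error r b :
  (forall phi, decision_rule X phi -> b <= worst_error X psi Q r phi) ->
  b <= minmax_error X psi Q r.
Proof.
move=> bphi; apply: lb_le_inf => [|_ [phi dphi <-]]; last exact: bphi.
exists (worst_error X psi Q r (fun _ _ => m%:R^-1)), (fun _ _ => m%:R^-1) => //.
exact: uniform_rule.
Qed.

Lemma minmax_error_mono r s : 0 <= r -> r <= s ->
  minmax_error X psi Q r <= minmax_error X psi Q s.
Proof.
move=> r0 rs; apply: le_minmax_error => phi dphi.
apply: (le_trans (minmax_error_le r0 dphi)).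
apply: worst_error_le => // P UP; apply: worst_error_ub => // i.
exact: uncertainty_mono rs _ _.
Qed.

(** The error is affine in the distributions and nonnegative at [Q0], so mixing with [Q0] keeps at
    least the fraction [t] of the error of [P]. *)
Lemma minmax_error_shrink r s : 0 < r -> r <= s ->
  r / s * minmax_error X psi Q s <= minmax_error X psi Q r.
Proof.
move=> r0 rs; have s0 := lt_le_trans r0 rs; have s0' := ltW s0.
set t := r / s; have t0 : 0 < t by exact: divr_gt0.
have t1 : t <= 1 by rewrite ler_pdivrMr// mul1r.
(* Dividing by [t] isolates the minmax error at [s], which the same rule [phi] bounds, competitor by
   competitor. *)
apply: le_minmax_error => phi dphi; rewrite mulrC -ler_pdivlMr//.
apply: (le_trans (minmax_error_le s0' dphi)); apply: worst_error_le => // P UP.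
rewrite ler_pdivlMr// mulrC.
have /choice[P' P'P] : forall i, exists P' : probability T R,
    uncertainty_set X psi Q r i P' /\ expect X P' (phi i) =
      t * expect X (P i) (phi i) + (1 - t) * expect X (Q0 i) (phi i).
  move=> i; have [|P' [P'PQ P'f]] := @Rintegral_mixture _ _ _ _ mX (P i) (Q0 i) t.
    by rewrite ltW.
  have [PX Pr] := UP i.
  exists P'; split; last first.
    apply: (P'f _ 1); first by case: dphi.
    by move=> x Xx; exact: decision_rule_normr.
  split; first by rewrite P'PQ// PX Q0X !mule1 -EFinD addrC subrK.
  move=> k; have [M psiM] := within_continuous_bounded cX (@cpsi k).
  have P'psi := P'f _ _ (within_continuous_borel mX (@cpsi k)) psiM.
  rewrite expect_model [expect _ P' _]P'psi.
  (* Relative to the empirical moment only the share of [P i] remains: [t] times a deviation of at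
     most [s], and [t * s = r]. *)
  rewrite (_ : _ - _ = t * (expect X (P i) (psi k) - expect X (Q0 i) (psi k))).
    rewrite normrM (gtr0_norm t0) -expect_model.
    have := ler_pM (ltW t0) (normr_ge0 _) (lexx t) (Pr k).
    by rewrite divfK ?gt_eqF.
  by rewrite /expect; ring.
apply: le_trans (worst_error_ub dphi (fun i => (P'P i).1)).
have /andP[Q00 _] := error_bounds Q0 dphi.
have -> : error_prob X phi P' =
    t * error_prob X phi P + (1 - t) * error_prob X phi Q0.
  rewrite /error_prob; under eq_bigr do rewrite (P'P _).2.
  by rewrite big_split/= -!mulr_sumr; ring.
by rewrite lerDl mulr_ge0// subr_ge0.
Qed.

(** For [x <= y], shrinking gives [g y - g x <= (1 - x / y) * g y], which is at most [(y - x) / y]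
    since [g y <= 1], and [y >= a]. *)
Lemma minmax_error_lipschitz (a b : R) : 0 < a ->
  a^-1.-lipschitz_(`[a, b] : set R) (minmax_error X psi Q).
Proof.
move=> a0 [x y] [/= + +]; rewrite !in_itv/= => /andP[ax _] /andP[ay _].
wlog xy : x y ax ay / x <= y => [h|].
  have [|/ltW] := leP x y; first exact: h.
  by rewrite distrC (distrC x); exact: h.
have x0 := lt_le_trans a0 ax; have y0 := lt_le_trans a0 ay.
set g := minmax_error X psi Q.
rewrite distrC ger0_norm; last by rewrite subr_ge0 minmax_error_mono// ltW.
rewrite distrC ger0_norm ?subr_ge0//.
apply: (@le_trans _ _ ((y - x) / y)).
  have := minmax_error_shrink x0 xy.
  have := minmax_error_le1 (ltW y0); rewrite -/g => g1 gxy.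
  apply: (@le_trans _ _ ((1 - x / y) * g y)); first by rewrite mulrBl mul1r lerB.
  rewrite (_ : (y - x) / y = 1 - x / y); last by rewrite mulrBl divff ?gt_eqF.
  by rewrite ler_piMr// subr_ge0 ler_pdivrMr// mul1r.
by rewrite mulrC ler_wpM2r ?subr_ge0// lef_pV2 ?posrE.
Qed.

(** * Passing between distributions and rules on [X] and on the grid *)

Section discretization.
Variables (N : nat) (z : 'I_N -> E) (c : E -> 'I_N).
Hypothesis z_inj : injective z.
Hypothesis zX : forall j, X (z j).
Hypothesis mc : forall j, measurable ([set x | X x /\ c x = j] : set T).

Let cell j : set T := [set x | X x /\ c x = j].

Lemma trivIset_cells : trivIset setT cell.
Proof. by move=> i j _ _ [x [[_ <-] [_ <-]]]. Qed.

Lemma bigcup_cells : \bigcup_j cell j = X.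
Proof.
by apply/seteqP; split=> [x [j _ []]//|x Xx]; exists (c x).
Qed.

Lemma measurable_grid_range : measurable (range z : set T).
Proof.
rewrite (_ : range z = \bigcup_j [set z j]); last first.
  by apply/seteqP; split=> [x [j _ <-]|x [j _ ->]]; exists j.
by apply: fin_bigcup_measurable => // j _; exact: set1_borel.
Qed.

(** The singletons serve as cells; injectivity of [z] makes them disjoint. *)
Lemma expect_grid (P : probability T R) f M :
  measurable_fun (X : set T) (f : T -> R) -> (forall x, X x -> `|f x| <= M) ->
  P (range z : set T) = 1%E ->
  expect X P f = \sum_(j < N) f (z j) * fine (P ([set z j] : set T)).
Proof.
move=> mf fM Pz.
apply: (@Rintegral_cells _ _ _ _ mX _ _ (fun j => [set z j]) _ _ M) => //.
- by move=> j; exact: set1_borel.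
- by move=> i j _ _ [x [-> /z_inj]].
- by move=> j x ->.
- rewrite -Pz; congr (P _); apply/seteqP; split=> x [j _].
    by move=> ->; exists j.
  by move=> <-; exists j.
- by move=> j x ->.
Qed.

Lemma expect_cells (P : probability T R) (a : 'I_N -> R) :
  P (X : set T) = 1%E ->
  expect X P (fun x => a (c x)) = \sum_(j < N) a j * fine (P (cell j)).
Proof.
move=> PX; have mac : measurable_fun (X : set T) (fun x : T => a (c x)).
  exact: measurable_comp_cells.
(* The integrand takes finitely many values, so the sum of their absolute values bounds it. *)
apply: (@Rintegral_cells _ _ _ _ mX _ _ _ _ _ (\sum_j `|a j|)) => //.
- by move=> x _; rewrite (bigD1 (c x))//= lerDl sumr_ge0.
- exact: trivIset_cells.
- by move=> j x [].
- by rewrite bigcup_cells.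
- by move=> j x [_ <-].
Qed.

Lemma grid_uncertainty_sub r i :
  grid_uncertainty_set X psi Q z r i `<=` uncertainty_set X psi Q r i.
Proof.
move=> P [Pz Pr]; split=> //; apply/eqP; rewrite eq_le probability_le1//= -Pz.
by apply: le_measure; rewrite ?inE//; [exact: measurable_grid_range|move=> _ [j _ <-]].
Qed.

Lemma grid_error_restrict phi P : decision_rule X phi ->
  (forall i, P i (range z : set T) = 1%E) ->
  grid_error z (fun i j => phi i (z j)) P = error_prob X phi P.
Proof.
move=> dphi Pz; congr (1 - _ * _); apply: eq_bigr => i _; symmetry.
apply: (@expect_grid _ _ 1) => //; first by case: dphi.
by move=> x; exact: decision_rule_normr.
Qed.

Lemma grid_rule_restrict phi : decision_rule X phi ->
  grid_rule (fun i j => phi i (z j)).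
Proof. by move=> [_ phi01 phi1]; split=> [i j|j]; [exact: phi01|exact: phi1]. Qed.

(** [P'] is the pushforward of [P0] under the map sending each point of [X] to its assigned grid
    point. The map is the identity off [X], which keeps it measurable on the whole space. *)
Lemma discretize (P0 : probability T R) : P0 (X : set T) = 1%E ->
  exists P' : probability T R, P' (range z : set T) = 1%E /\
    forall j, P' ([set z j] : set T) = P0 (cell j).
Proof.
move=> P0X; pose f (x : T) : T := if x \in X then z (c x) else x.
have fX x : X x -> f x = z (c x) by move=> Xx; rewrite /f mem_set.
have fNX x : ~ X x -> f x = x by move=> Xx; rewrite /f memNset.
have mf : measurable_fun setT f.
  move=> _ B mB; rewrite (_ : _ `&` _ =
      (X `&` (fun x => z (c x)) @^-1` B) `|` (~` X `&` B)); last first.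
    apply/seteqP; split=> x /=.
      by case=> _; have [Xx|Xx] := pselect (X x);
        [rewrite fX//; left|rewrite fNX//; right].
    by case=> [[Xx Bx]|[Xx Bx]]; split=> //; [rewrite fX|rewrite fNX].
  apply: measurableU; last by apply: measurableI => //; exact: measurableC.
  exact: (@measurable_comp_cells _ _ T T X N c z).
have [P' P'f] := probability_pushforward P0 mf.
exists P'; rewrite P'f; split=> [|j].
  have mpre : measurable (f @^-1` range z).
    by rewrite -[X in measurable X]setTI; apply: mf => //; exact: measurable_grid_range.
  apply/eqP; rewrite eq_le probability_le1//= -P0X.
  by apply: le_measure; rewrite ?inE// => x Xx; exists (c x) => //; rewrite fX.
rewrite P'f; congr (P0 _); apply/seteqP; split=> x /=.
  have [Xx|Xx] := pselect (X x); first by rewrite fX// => /z_inj.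
  (* A fixed point outside [X] cannot be a grid point, as these lie in [X]. *)
  by rewrite fNX// => xz; case: Xx; rewrite xz.
by move=> [Xx <-]; rewrite fX.
Qed.

(** The norm, the Lipschitz bounds and the covering radius enter the comparison only through
    [psi_close]. *)
Variable eps : R.
Hypothesis psi_close : forall k x, X x -> `|psi k (z (c x)) - psi k x| <= eps.

(** The sum is the integral of [psi k] composed with the assignment; the two integrands differ by at
    most [eps] on a set of mass 1. *)
Lemma expect_cells_close (P0 : probability T R) k : P0 (X : set T) = 1%E ->
  `|\sum_(j < N) psi k (z j) * fine (P0 (cell j)) - expect X P0 (psi k)| <= eps.
Proof.
move=> P0X; have [M psiM] := within_continuous_bounded cX (@cpsi k).
have mpsi := within_continuous_borel mX (@cpsi k).
have mpsic : measurable_fun (X : set T) (fun x : T => psi k (z (c x)) : R).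
  exact: (@measurable_comp_cells _ _ T _ X N c (fun j => psi k (z j) : R) mc).
have mdiff := measurable_funB mpsic mpsi.
have intpsi := bounded_integrable mX P0 mpsi psiM.
have intpsic :
    P0.-integrable (X : set T) (EFin \o (fun x : T => psi k (z (c x)))).
  by apply: bounded_integrable mpsic _ => // x _; exact: psiM.
have intdiff :
    P0.-integrable (X : set T) (EFin \o (fun x : T => psi k (z (c x)) - psi k x)).
  by apply: bounded_integrable mdiff _ => // x; exact: psi_close.
rewrite -(expect_cells (fun j => psi k (z j)))// /expect -RintegralB//.
apply: (le_trans (le_normr_Rintegral mX intdiff)).
rewrite [leRHS](_ : _ = \int[P0]_(x in (X : set T)) eps)%R; last first.
  by rewrite Rintegral_cst// [X in _ * fine X]P0X mulr1.
apply: le_Rintegral => //.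
- exact: integrable_norm.
- apply: (@bounded_integrable _ _ _ _ mX _ _ `|eps|) => //; exact: measurable_cst.
- exact: psi_close.
Qed.

(** The enlarged radius arises here, by the triangle inequality through the moment of [P0]. *)
Lemma discretize_uncertainty r i (P0 : probability T R) :
  uncertainty_set X psi Q r i P0 ->
  exists P' : probability T R, grid_uncertainty_set X psi Q z (r + eps) i P' /\
    forall j, P' ([set z j] : set T) = P0 (cell j).
Proof.
move=> [P0X P0r]; have [P' [P'z P'cell]] := discretize P0X.
exists P'; split=> //; split=> // k.
have [M psiM] := within_continuous_bounded cX (@cpsi k).
have mpsi := within_continuous_borel mX (@cpsi k).
rewrite (expect_grid mpsi psiM)//; under eq_bigr do rewrite P'cell.
rewrite -(subrKA (expect X P0 (psi k))) addrC (le_trans (ler_normD _ _))//.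
by rewrite lerD//; exact: expect_cells_close.
Qed.

(** The smoothed rule is constant on each cell, so its error depends only on the cell masses, which
    [P'] places at the grid points. *)
Lemma error_smoothed (phi : 'I_m -> 'I_N -> R) P P' :
  (forall i, P i (X : set T) = 1%E) ->
  (forall i j, P' i ([set z j] : set T) = P i (cell j)) ->
  error_prob X (smoothed_rule c phi) P = grid_error z phi P'.
Proof.
move=> PX P'P; congr (1 - _ * _); apply: eq_bigr => i _.
rewrite (expect_cells (phi i))//.
by apply: eq_bigr => j _; rewrite P'P.
Qed.

Let grid_errors r (phi : 'I_m -> 'I_N -> R) := [set grid_error z phi P |
  P in [set P | forall i, grid_uncertainty_set X psi Q z r i (P i)]].

Lemma grid_error_le1 (phi : 'I_m -> 'I_N -> R) P :
  grid_rule phi -> grid_error z phi P <= 1.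
Proof.
move=> [phi01 _]; rewrite gerBl mulr_ge0 ?invr_ge0// sumr_ge0// => i _.
rewrite sumr_ge0// => j _; rewrite mulr_ge0//; first by have /andP[] := phi01 i j.
exact: fine_ge0.
Qed.

Lemma smoothed_worst_error r (phi : 'I_m -> 'I_N -> R) :
  0 <= r -> grid_rule phi ->
  worst_error X psi Q r (smoothed_rule c phi) <=
  grid_worst_error X psi Q z (r + eps) phi.
Proof.
move=> r0 gphi; apply: worst_error_le => // P UP.
have /choice[P' P'P] := fun i => discretize_uncertainty (UP i).
rewrite (@error_smoothed _ _ P'); last 2 first.
- by move=> i; have [] := UP i.
- by move=> i; have [] := P'P i.
apply: (@ub_le_sup _ (grid_errors (r + eps) phi)).
  by exists 1 => _ [P1 _ <-]; exact: grid_error_le1.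
by exists P' => // i; have [] := P'P i.
Qed.

Lemma grid_worst_error_restrict r phi : 0 <= r -> decision_rule X phi ->
  grid_worst_error X psi Q z (r + eps) (fun i j => phi i (z j)) <=
  worst_error X psi Q (r + eps) phi.
Proof.
move=> r0 dphi.
apply: (@ge_sup _ (grid_errors (r + eps) (fun i j => phi i (z j)))).
  have /choice[P' P'P] := fun i => discretize_uncertainty (model_uncertainty i r0).
  by exists (grid_error z (fun i j => phi i (z j)) P'), P' => // i; have [] := P'P i.
move=> _ [P UP <-]; rewrite grid_error_restrict//; last by move=> i; have [] := UP i.
by apply: worst_error_ub => // i; apply: grid_uncertainty_sub.
Qed.

Lemma smoothed_worst_error_minmax r (phi : 'I_m -> 'I_N -> R) : 0 <= r ->
  optimal_grid_rule X psi Q z (r + eps) phi ->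
  worst_error X psi Q r (smoothed_rule c phi) <= minmax_error X psi Q (r + eps).
Proof.
move=> r0 [gphi phi_opt].
apply: (le_trans (smoothed_worst_error r0 gphi)).
(* The infimum over rules on [X] need not be attained, so the comparison is made with every
   [phi']. *)
apply: le_minmax_error => phi' dphi'.
apply: (le_trans (phi_opt _ (grid_rule_restrict dphi'))).
exact: grid_worst_error_restrict.
Qed.
End discretization.
End testing.

(** * Least Lipschitz constants, norms and empirical measures *)

Lemma least_lipschitz_constant (R : realType) (D : set R) (g : R -> R) (k : R) :
  (exists x y, [/\ D x, D y & x != y]) -> k.-lipschitz_D g ->
  exists L, is_lipschitz_constant D g L.
Proof.
move=> [x0 [y0 [Dx0 Dy0 xy0]]] gk.
pose C := [set L | L.-lipschitz_D g].
(* Two distinct points of [D] force every Lipschitz constant to be nonnegative. *)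
have C0 : lbound C 0.
  move=> L /(_ (x0, y0)) /= /(_ (conj Dx0 Dy0)) /(le_trans (normr_ge0 _)).
  by rewrite pmulr_lge0// normr_gt0 subr_eq0.
have Ck : C !=set0 by exists k.
exists (inf C); split=> [[x y] [/= Dx Dy]|L' CL']; last by apply: ge_inf => //; exists 0.
have [->|xy] := eqVneq x y; first by rewrite !subrr !normr0 mulr0.
have xy0' : 0 < `|x - y| by rewrite normr_gt0 subr_eq0.
(* Each difference quotient is a lower bound of all the constants, hence of their infimum, which is
   thus itself a constant. *)
rewrite -ler_pdivrMr//; apply: lb_le_inf => // L /(_ (x, y)) /= /(_ (conj Dx Dy)).
by rewrite ler_pdivrMr.
Qed.

Section norm.
Context {R : realType} {d : nat} (nrm : 'rV[R]_d -> R).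
Hypothesis hnrm : is_norm nrm.

Lemma is_normN x : nrm (- x) = nrm x.
Proof. by have [_ nZ _] := hnrm; rewrite -scaleN1r nZ normrN1 mul1r. Qed.

(** Follows from the triangle inequality: [0 = nrm (x - x) <= 2 * nrm x]. *)
Lemma is_norm_ge0 x : 0 <= nrm x.
Proof.
have [nD nZ _] := hnrm; have := nD x (- x).
by rewrite subrr -(scale0r 0) nZ normr0 mul0r is_normN -mulr2n pmulrn_lge0.
Qed.
End norm.

(** Applied to the whole space for the total mass, and to [X] for the support. *)
Lemma empirical_eq1 (R : realType) (d n : nat) (xhat : nat -> 'rV[R]_d)
    (A : set (borelRV R d)) : (0 < n)%N -> (forall j, (j < n)%N -> A (xhat j)) ->
  empirical n xhat A = 1%E.
Proof.
move=> n0 xA; rewrite /empirical/= /mscale/= /msum.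
under eq_bigr => j _ do rewrite /= diracE (mem_set (xA j (ltn_ord j))).
rewrite sumEFin -EFinM; congr EFin.
by rewrite sumr_const card_ord mulVf// pnatr_eq0 -lt0n.
Qed.

(** * The optimality gap of the smoothed rule *)

Theorem theorem5 (R : realType) (d : nat) (nrm : 'rV[R]_d -> R)
  (hnrm : is_norm nrm)
  (X : set 'rV[R]_d)
  (hXcube : forall x, X x -> forall l, 0 <= x 0 l <= 1)
  (hXinf : infinite_set X) (hXcompact : compact X)
  (m : nat) (hm : (2 <= m)%N)
  (K : nat) (psi : 'I_K -> 'rV[R]_d -> R) (L : 'I_K -> R)
  (hpsi : forall k, {within X, continuous (psi k)})
  (hL : forall k, lipschitz_wrt nrm X (psi k) (L k))
  (hLmax : \big[Num.max/0]_(k < K) L k = 1)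
  (n : 'I_m -> nat) (hn : forall i, (0 < n i)%N)
  (xhat : 'I_m -> nat -> 'rV[R]_d)
  (hxhat : forall i j, (j < n i)%N -> X (xhat i j))
  (Delta eta0 eta eps : R)
  (hDelta : 0 < Delta) (hDeltaeta0 : Delta < eta0)
  (heta0 : (eta0%:E < eta_max X psi (fun i => empirical (n i) (xhat i)))%E)
  (heta : Delta <= eta <= eta0)
  (heps : 0 < eps) (hetaeps : eta + eps <= eta0)
  (N : nat) (hN : Posz N = Num.ceil (eps ^- d))
  (z : 'I_N -> 'rV[R]_d)
  (hgrid : is_grid z) (hzX : forall j, X (z j))
  (hcover : forall x, X x -> exists j, nrm (z j - x) <= eps)
  (phiN : 'I_m -> 'I_N -> R)
  (hphiN : optimal_grid_rule X psi (fun i => empirical (n i) (xhat i)) z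
             (eta + eps) phiN)
  (c : 'rV[R]_d -> 'I_N) (hc : nearest_assignment X z nrm c) :
  let g := minmax_error X psi (fun i => empirical (n i) (xhat i)) in
  let gamma := g eta in
  exists2 L0 : R, is_lipschitz_constant `[Delta, eta0] g L0 &
    worst_error X psi (fun i => empirical (n i) (xhat i)) eta
      (smoothed_rule c phiN) - gamma <= L0 * eps.
Proof.
move=> g gamma.
have m0 : (0 < m)%N by exact: ltn_trans hm.
have [D0 Deta] := andP heta.
have eta0' : 0 <= eta by apply: ltW; exact: lt_le_trans D0.
pose Q i := empirical (n i) (xhat i).
have /choice[Q0 Q0Q] : forall i,
    exists P : probability (borelRV R d) R, forall A, P A = Q i A.
  by move=> i; apply: probability_of_measure; exact: empirical_eq1.
have QQ0 i A : measurable A -> Q0 i A = Q i A by [].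
have Q0X i : Q0 i (X : set (borelRV R d)) = 1%E.
  by rewrite Q0Q; apply: empirical_eq1 => // j; exact: hxhat.
(* The constant [1 / Delta] only shows that some Lipschitz constant exists; [L0] is the least one,
   and [Delta < eta0] provides two distinct radii. *)
have glip := minmax_error_lipschitz hXcompact m0 hpsi QQ0 Q0X hDelta (b := eta0).
have [|L0 hL0] := least_lipschitz_constant _ glip.
  exists Delta, eta0; split; last by rewrite lt_eqF.
  - by rewrite /= in_itv/= lexx ltW.
  - by rewrite /= in_itv/= lexx ltW.
exists L0 => //.
have [z_inj _] := hgrid; have [c_near c_cell] := hc.
have L1 k : L k <= 1 by rewrite -hLmax; exact: le_bigmax.
have psi_close k x : X x -> `|psi k (z (c x)) - psi k x| <= eps.
  move=> Xx; apply: (le_trans (@hL k _ _ (hzX _) Xx)).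
  have [j zj] := hcover _ Xx.
  (* The assigned point is at least as close as the covering one; the sign flips reconcile the two
     orders of subtraction. *)
  have : nrm (z (c x) - x) <= eps.
    rewrite -(is_normN hnrm) opprB (le_trans (c_near _ Xx j))//.
    by rewrite -(is_normN hnrm) opprB.
  by apply: le_trans; rewrite ler_piMl// is_norm_ge0.
have := smoothed_worst_error_minmax hXcompact m0 hpsi QQ0 Q0X z_inj hzX c_cell
  psi_close eta0' hphiN.
rewrite -/Q -/g => smooth.
apply: (le_trans (lerB smooth (lexx _))).
(* Both radii lie in [[Delta, eta0]], at distance [eps]. *)
have [/(_ (eta + eps, eta)) /= hlip _] := hL0.
apply: (le_trans (ler_norm _)); apply: (le_trans (hlip _)).
  by rewrite !in_itv/= D0 hetaeps/= Deta (le_trans D0)// lerDl ltW.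
by rewrite addrAC subrr add0r gtr0_norm.
Qed.
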